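(* The independence polynomial $I(T_{m,n};t)$ is unimodal for all integers $m\geq 3$ and $n\geq 1$. Moreover, for all $m\geq 4$ and $n\geq 1$, its mode $\mu_{m,n}$ satisfies $$\lambda_{m-3}+\lambda_n-1\leq \mu_{m,n}\leq \lambda_{m-3}+\lambda_n+2.$$
   Context: Graphs are finite and simple. For integers $m\geq 3$ and $n\geq 1$, the tadpole graph $T_{m,n}$ is obtained from the disjoint union of the cycle $C_m$ with vertices $x_1,\ldots,x_m$ (edges $\{x_i,x_{i+1}\}$ for $1\le i<m$, and $\{x_m,x_1\}$) and the path $P_n$ with vertices $y_1,\ldots,y_n$ (edges $\{y_j,y_{j+1}\}$ for $1\le j<n$) by adding the edge $\{x_m,y_1\}$. The independence polynomial of a graph $G$ is $I(G;t)=\sum_{k\ge 0} s_k(G)t^k$, where $s_k(G)$ is the number of independent sets (sets of pairwise nonadjacent vertices) of size $k$ in $G$; $s_0(G)=1$. A nonzero polynomial $\sum_{k=0}^{N}a_kx^k$ with nonnegative real coefficients is unimodal if there is an integer $p$ with $a_0\leq a_1\leq\cdots\leq a_p\geq a_{p+1}\geq\cdots\geq a_N$. Setting $a_{-1}=0$, its mode is the unique integer $i\in\{0,\ldots,N\}$ with $a_{i-1}<a_i\geq a_{i+1}\geq\cdots\geq a_N$. For $n\ge 1$, $\lambda_n=\left\lceil \dfrac{5n+2-\sqrt{5n^2+20n+24}}{10}\right\rceil$; this is the mode of the independence polynomial of the path $P_n$ on $n$ vertices. *)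

(* Defs.v *)
From HB Require Import structures.
From mathcomp Require Import all_boot all_order all_algebra.
From mathcomp Require Import reals.

Set Implicit Arguments.
Unset Strict Implicit.
Unset Printing Implicit Defensive.

Import Order.TTheory GRing.Theory Num.Theory.

Local Open Scope ring_scope.

Section IndependencePolynomial.
Variables (T : finType) (e : rel T).

Definition independent (A : {set T}) : bool :=
  [forall x in A, forall y in A, (x != y) ==> ~~ e x y].

Definition nb_indep (k : nat) : nat :=
  #|[set A : {set T} | independent A & #|A| == k]|.

Definition indep_poly (R : realType) : {poly R} :=
  \poly_(k < #|T|.+1) (nb_indep k)%:R.

End IndependencePolynomial.

(* The vertex x_i (1 <= i <= m) is [inl] of the ordinal i - 1, and
   y_j (1 <= j <= n) is [inr] of the ordinal j - 1. *)
Definition tadpole_edge (m n : nat) (u v : 'I_m + 'I_n) : bool :=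
  match u, v with
  | inl i, inl j =>
      (i.+1 == j :> nat) || ((i.+1 == m :> nat) && (j == 0%N :> nat))
  | inr i, inr j => i.+1 == j :> nat
  | inl i, inr j => (i.+1 == m :> nat) && (j == 0%N :> nat)
  | inr _, inl _ => false
  end.

Definition tadpole (m n : nat) : rel ('I_m + 'I_n)%type :=
  fun u v => tadpole_edge u v || tadpole_edge v u.

Lemma tadpole_sym (m n : nat) : symmetric (@tadpole m n).
Proof. by move=> u v; rewrite /tadpole orbC. Qed.

Lemma tadpole_irr (m n : nat) : (3 <= m)%N -> irreflexive (@tadpole m n).
Proof.
move=> m3 [i|j]; rewrite /tadpole orbb /=; last by rewrite gtn_eqF.
rewrite gtn_eqF //=; apply/negbTE/andP => -[/eqP im /eqP i0].
by move: m3; rewrite -im i0.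
Qed.

Section Unimodality.
Variable R : realType.
Implicit Type p : {poly R}.

(* The degree N of p is (size p).-1. *)
Definition unimodal p : Prop :=
  [/\ p != 0, forall k, 0 <= p`_k &
      exists2 i : nat, (i < size p)%N &
        (forall k, (k < i)%N -> p`_k <= p`_k.+1) /\
        (forall k, (i <= k)%N -> (k.+1 < size p)%N -> p`_k.+1 <= p`_k)].

Definition is_mode p (i : nat) : Prop :=
  [/\ (i < size p)%N,
      (if i is j.+1 then p`_j else 0) < p`_i &
      forall k, (i <= k)%N -> (k.+1 < size p)%N -> p`_k.+1 <= p`_k].

Lemma is_mode_uniq p i j : is_mode p i -> is_mode p j -> i = j.
Proof.
wlog ltij : i j / (i < j)%N => [th|] pi pj.
  by case: (ltngtP i j) => // ij; [exact: th | apply/esym/th].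
case: pi pj => _ _ dec; case: j ltij => // j ij [sj lt _].
by have := dec j ij sj; rewrite leNgt lt.
Qed.

End Unimodality.

Definition lambda (R : realType) (n : nat) : int :=
  Num.ceil ((5 * n%:R + 2 - Num.sqrt (5 * n%:R ^+ 2 + 20 * n%:R + 24)) / 10 : R).

(* Main.v *)
(* Let P_n be the independence polynomial of the path on n - 1 vertices.
   Deleting the vertex x_m gives T = P_m P_(n+1) + t P_(m-2) P_n. Each P_n is
   log-concave and P_(n-1) <= P_n <= t P_(n-1) for the likelihood-ratio order,
   which is compatible with products; so the two summands of T are synchronised
   and T is log-concave, hence unimodal.

   The k-th coefficient 'C(n - k, k) of P_n increases up to the ceiling of
   rho (n + 1), where rho x = (5 x - 8 - sqrt (5 x^2 + 4)) / 10 comes from a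
   quadratic equation. The identity P_(a+2) P_(b+2) = P_(a+b+3) + t^2 P_a P_b
   turns the two summands of T into positive combinations of t^(2i) P_j whose
   modes increase with i, which yields the lower bound on the mode. It also
   gives, with s = m + n,
     T = P_(s+1) - t^2 P_n P_(m-3)
       = P_(s-1) + t P_(s-3) + t P_(s-1) - t^4 P_(n-2) P_(m-5),
   and just after the mode of t P_(s-1) the three positive terms decrease while
   the subtracted one still increases, which yields the upper bound. *)
Require Import Defs.
From mathcomp Require Import all_boot all_order all_algebra.
From mathcomp Require Import reals.
From mathcomp Require Import ring lra zify.

Set Implicit Arguments.
Unset Strict Implicit.
Unset Printing Implicit Defensive.

Import Order.TTheory GRing.Theory Num.Theory.

Local Open Scope ring_scope.

(** * The likelihood-ratio order and log-concavity *)

Section RatioOrder.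
Variable R : realDomainType.
Implicit Types (p q r : {poly R}) (i j k d : nat).

Definition nneg_poly p := forall k, 0 <= p`_k.

Lemma nneg_polyM p q : nneg_poly p -> nneg_poly q -> nneg_poly (p * q).
Proof.
by move=> p0 q0 k; rewrite coefM sumr_ge0 // => i _; rewrite mulr_ge0.
Qed.

Lemma nneg_polyX : nneg_poly 'X.
Proof. by move=> k; rewrite coefX ler0n. Qed.

(* The likelihood-ratio order: q_k / p_k is nondecreasing in k, in a
   division-free form which makes sense when coefficients vanish. *)
Definition ratio_le p q := forall i j, (i <= j)%N -> p`_j * q`_i <= p`_i * q`_j.

Definition log_concave p := ratio_le p ('X * p).

Lemma ratio_lexx p : ratio_le p p.
Proof. by move=> i j _; rewrite mulrC. Qed.

Lemma ratio_leDl p q r : ratio_le p r -> ratio_le q r -> ratio_le (p + q) r.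
Proof. by move=> pr qr i j ij; rewrite !coefD !mulrDl lerD ?pr ?qr. Qed.

Lemma ratio_leDr p q r : ratio_le p q -> ratio_le p r -> ratio_le p (q + r).
Proof. by move=> pq pr i j ij; rewrite !coefD !mulrDr lerD ?pq ?pr. Qed.

Lemma ratio_leX p q : ratio_le p q -> ratio_le ('X * p) ('X * q).
Proof.
move=> pq [|i] [|j] ij; rewrite !coefXM /= ?mul0r ?mulr0 //.
exact: pq.
Qed.

Lemma ratio_leXn d p q : ratio_le p q -> ratio_le ('X^d * p) ('X^d * q).
Proof.
move=> pq; elim: d => [|d IH]; first by rewrite expr0 !mul1r.
by rewrite exprS -!mulrA; exact: ratio_leX.
Qed.

(** A positive q_i or q_j can be cancelled. If both vanish, some q_l is positive, which forces p_j =
    0 when l <= j and r_i = 0 when l > j. *)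
Lemma ratio_le_trans q p r : nneg_poly p -> nneg_poly q -> nneg_poly r ->
  q != 0 -> ratio_le p q -> ratio_le q r -> ratio_le p r.
Proof.
move=> p0 q0 r0 qN0 pq qr i j ij.
have h1 := ler_wpM2r (r0 i) (pq i j ij).
have h2 := ler_wpM2l (p0 i) (qr i j ij).
have h3 := ler_wpM2r (r0 j) (pq i j ij).
have h4 := ler_wpM2l (p0 j) (qr i j ij).
have := q0 i; rewrite le_eqVlt => /orP[/eqP qi|qi]; last first.
  by rewrite -(ler_pM2l qi); lra.
have := q0 j; rewrite le_eqVlt => /orP[/eqP qj|qj]; last first.
  by rewrite -(ler_pM2l qj); lra.
have [l ql] : exists l, 0 < q`_l.
  exists (size q).-1; rewrite lt_def q0 andbT.
  by rewrite -lead_coefE lead_coef_eq0.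
case: (leqP l j) => lj.
  have := pq _ _ lj; rewrite -qj mulr0 pmulr_lle0 // => pj.
  have -> : p`_j = 0 by apply/eqP; rewrite eq_le pj p0.
  by rewrite mul0r mulr_ge0.
have := qr _ _ (leq_trans ij (ltnW lj)).
rewrite -qi mul0r pmulr_rle0 // => ri.
have -> : r`_i = 0 by apply/eqP; rewrite eq_le ri r0.
by rewrite mulr0 mulr_ge0.
Qed.

(** Transitivity along p <= t p <= t^2 p <= ...; this extends log-concavity from adjacent shifts to
    all 2 x 2 Toeplitz minors. *)
Lemma log_concaveXn d p : nneg_poly p -> log_concave p -> ratio_le p ('X^d * p).
Proof.
move=> p0 lc; have [->|pN0] := eqVneq p 0.
  by rewrite mulr0; exact: ratio_lexx.
have X0 e : nneg_poly ('X^e * p).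
  elim: e => [|e IH]; first by rewrite mul1r.
  by rewrite exprS -mulrA; apply: nneg_polyM IH; exact: nneg_polyX.
elim: d => [|d IH]; first by rewrite mul1r; exact: ratio_lexx.
apply: ratio_le_trans IH _ => //.
  by rewrite mulf_neq0 // expf_neq0 // polyX_eq0.
by rewrite exprSr -mulrA; exact: ratio_leXn.
Qed.

(* Cauchy-Binet: the sum over (x, y) is antisymmetrised, and every term of the
   result is a product of a 2 x 2 minor of the Toeplitz matrix of r with a
   minor of (p, q). *)
Lemma ratio_leMl p q r : nneg_poly r -> log_concave r ->
  ratio_le p q -> ratio_le (r * p) (r * q).
Proof.
move=> r0 lc pq i j ij.
pose N := maxn (size p) (size q).
have coefrM (s : {poly R}) k : (size s <= N)%N ->
    (r * s)`_k = \sum_(x < N) s`_x * ('X^x * r)`_k.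
  move=> sN; rewrite mulrC.
  have {1}-> : s = \sum_(x < N) s`_x *: 'X^x.
    rewrite -poly_def; apply/polyP=> x; rewrite coef_poly.
    by case: ltnP => // /(leq_trans sN) /(nth_default 0).
  by rewrite mulr_suml coef_sum; apply: eq_bigr => x _; rewrite -scalerAl coefZ.
rewrite !coefrM ?leq_maxl ?leq_maxr // !big_distrlr /=.
pose D (x y : nat) :=
  ('X^x * r)`_i * ('X^y * r)`_j - ('X^x * r)`_j * ('X^y * r)`_i.
have D_ge0 x y : (x <= y)%N -> 0 <= D x y.
  move=> xy; have := ratio_leXn x (log_concaveXn (y - x) r0 lc) ij.
  by rewrite mulrA -exprD subnKC // subr_ge0.
rewrite -subr_ge0 -sumrB.
under eq_bigr do rewrite -sumrB.
rewrite (_ : \sum_x _ = \sum_(x < N) \sum_(y < N) p`_x * q`_y * D x y); last first.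
  by apply: eq_bigr => x _; apply: eq_bigr => y _; rewrite /D; ring.
set S := \sum_x _.
suff : 0 <= S + S by lra.
rewrite {2}/S exchange_big -big_split /=; apply: sumr_ge0 => x _.
rewrite -big_split /=; apply: sumr_ge0 => y _.
have -> : p`_x * q`_y * D x y + p`_y * q`_x * D y x =
    (p`_x * q`_y - p`_y * q`_x) * D x y.
  by rewrite /D; ring.
case: (leqP x y) => xy; first by rewrite mulr_ge0 ?D_ge0 // subr_ge0 pq.
have -> : D x y = - D y x by rewrite /D; ring.
rewrite mulrN -mulNr opprB mulr_ge0 ?D_ge0 1?ltnW // subr_ge0.
by rewrite pq // ltnW.
Qed.

Lemma log_concaveD p q : log_concave p -> log_concave q ->
  ratio_le p ('X * q) -> ratio_le q ('X * p) -> log_concave (p + q).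
Proof.
move=> lp lq pq qp; rewrite /log_concave mulrDr.
by apply: ratio_leDl; apply: ratio_leDr.
Qed.

(** The mode is the first degree from which the coefficients fail to rise; log-concavity propagates
    this failure to all later degrees. *)
Lemma log_concave_mode p : nneg_poly p -> 0 < p`_0 -> log_concave p ->
  exists i, [/\ (i < size p)%N, 0 < p`_i,
    forall k, (k < i)%N -> p`_k < p`_k.+1 &
    forall k, (i <= k)%N -> p`_k.+1 <= p`_k].
Proof.
move=> p0 p00 lc.
have ex : exists k, p`_k.+1 <= p`_k.
  by exists (size p); rewrite (nth_default 0 (leqnSn _)).
pose i := ex_minn ex; exists i.
have up k : (k < i)%N -> p`_k < p`_k.+1.
  rewrite /i; case: ex_minnP => l _ lmin kl; rewrite ltNge.
  by apply/negP => /lmin; rewrite leqNgt kl.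
have pi_gt0 : 0 < p`_i.
  by case: (i) up => // l up; exact: le_lt_trans (p0 l) (up _ (leqnn _)).
split=> //.
  rewrite ltnNge; apply/negP => /(nth_default 0) pi.
  by rewrite pi ltxx in pi_gt0.
move=> k ik; have := lc i.+1 k.+1 ik; rewrite !coefXM /= => h.
rewrite -(ler_pM2r pi_gt0); apply: le_trans h _.
by rewrite mulrC ler_wpM2l // /i; case: ex_minnP.
Qed.

End RatioOrder.

(** * Identities between path polynomials *)

Section PathPolynomials.
Variable R : comNzRingType.

(* The independence polynomial of the path on n - 1 vertices; the two values 1
   at n = 0, 1 keep the recurrence valid from the start. *)
Fixpoint path_poly (n : nat) : {poly R} :=
  if n is n'.+1 then
    if n' is n''.+1 then path_poly n' + 'X * path_poly n'' else 1
  else 1.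

Lemma path_polySS n : path_poly n.+2 = path_poly n.+1 + 'X * path_poly n.
Proof. by []. Qed.

Lemma coef_path_poly n k : (path_poly n)`_k = 'C(n - k, k)%:R.
Proof.
elim/ltn_ind: n k => -[|[|n]] IH k.
- by rewrite sub0n coef1; case: k.
- by rewrite coef1; case: k => [|k] //; rewrite subSS sub0n.
case: k => [|k]; first by rewrite path_polySS coefD coefXM IH //= addr0 !bin0.
rewrite path_polySS coefD coefXM !IH // -natrD; congr (_%:R).
rewrite !subSS; case: (leqP k n) => kn; first by rewrite subSn // binS addnC.
have /eqP-> : (n.+1 - k == 0)%N by rewrite subn_eq0.
have /eqP-> : (n - k == 0)%N by rewrite subn_eq0 ltnW.
by rewrite !bin_small // (leq_ltn_trans _ kn).
Qed.

(** Joining two disjoint paths, on a + 1 and b + 1 vertices, by an edge between their ends loses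
    exactly the sets containing both ends; these give the t^2 term. *)
Lemma path_polyM a b : path_poly a.+2 * path_poly b.+2 =
  path_poly (a + b).+3 + 'X^2 * (path_poly a * path_poly b).
Proof.
elim/ltn_ind: b => -[|[|b]] IH.
- by rewrite addn0 !path_polySS /=; ring.
- by rewrite addn1 !path_polySS /=; ring.
rewrite (path_polySS b.+2) (path_polySS b) mulrDr mulrCA !IH // !addnS.
by rewrite (path_polySS (a + b).+3); ring.
Qed.

(* The tadpole is a path on m + n vertices, m = a + 4, plus the edge x_1 x_m;
   the subtracted term counts the sets containing both x_1 and x_m. *)
Lemma tadpole_polyE a n :
  path_poly a.+4 * path_poly n.+1 + 'X * (path_poly a.+2 * path_poly n) =
  path_poly (a + n).+4.+1 - 'X^2 * (path_poly a.+1 * path_poly n).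
Proof.
elim/ltn_ind: n => -[|[|n]] IH.
- by rewrite addn0 !path_polySS /=; ring.
- by rewrite addn1 !path_polySS /=; ring.
have := IH n.+1 (leqnn _); have := IH n (leqnSn _); rewrite !addnS => IH0 IH1.
rewrite (path_polySS n.+1) {2}(path_polySS n) (path_polySS (a + n).+4.+1).
transitivity (
  (path_poly a.+4 * path_poly n.+2 + 'X * (path_poly a.+2 * path_poly n.+1)) +
  'X * (path_poly a.+4 * path_poly n.+1 + 'X * (path_poly a.+2 * path_poly n))).
  by ring.
by rewrite IH0 IH1 (path_polySS n); ring.
Qed.

End PathPolynomials.

(** * Log-concavity for paths and tadpoles *)

Section PathRatios.
Variable R : realDomainType.
Local Notation P := (path_poly R).

Lemma path_poly_nneg n : nneg_poly (P n).
Proof. by move=> k; rewrite coef_path_poly ler0n. Qed.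
#[local] Hint Resolve path_poly_nneg nneg_polyX : core.

Lemma path_polyXnneg n : nneg_poly ('X * P n).
Proof. exact: nneg_polyM. Qed.
#[local] Hint Resolve path_polyXnneg : core.

Lemma path_poly_neq0 n : P n != 0.
Proof.
apply/eqP => /(congr1 (fun p : {poly R} => p`_0)) /eqP.
by rewrite coef_path_poly bin0 coef0 oner_eq0.
Qed.

Lemma path_polyX_neq0 n : 'X * P n != 0.
Proof. by rewrite mulf_neq0 ?polyX_eq0 ?path_poly_neq0. Qed.

(** The three claims need a joint induction: log-concavity of P_(n+1) is the chain P_(n+1) <= t P_n
    <= t P_(n+1). *)
Lemma path_poly_ratio n :
  [/\ ratio_le (P n) (P n.+1), ratio_le (P n.+1) ('X * P n)
    & log_concave (P n)].
Proof.
elim: n => [|n [le1 le2 lc]].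
  have one_leX : ratio_le (1 : {poly R}) ('X * 1).
    by move=> [|i] [|j] // _; rewrite mulr1 !coef1 !coefX /=;
      rewrite ?mulr0 ?mul0r // mul1r ler0n.
  by split => //; exact: ratio_lexx.
have lc' : log_concave (P n.+1).
  by apply: (ratio_le_trans _ _ _ (path_polyX_neq0 n) le2) => //; exact: ratio_leX.
split=> //; rewrite path_polySS.
- by apply: ratio_leDr => //; exact: ratio_lexx.
- by apply: ratio_leDl => //; exact: ratio_leX.
Qed.

Lemma path_poly_log_concave n : log_concave (P n).
Proof. by case: (path_poly_ratio n). Qed.

(** The two cross comparisons between the summands change one factor at a time, through t P_(m+2)
    P_n and P_(m+2) P_n respectively. *)
Lemma tadpole_poly_log_concave m n :
  log_concave (P m.+2 * P n.+1 + 'X * (P m * P n)).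
Proof.
have lcM a b : log_concave (P a * P b).
  rewrite /log_concave mulrCA.
  by apply: ratio_leMl; rewrite ?path_poly_log_concave //; exact: path_poly_log_concave.
have [n1 n2 _] := path_poly_ratio n; have [m1 m2 _] := path_poly_ratio m.
have mSS1 : ratio_le (P m) (P m.+2).
  by rewrite path_polySS; apply: ratio_leDr => //; exact: path_poly_log_concave.
have mSS2 : ratio_le (P m.+2) ('X * P m).
  by rewrite path_polySS; apply: ratio_leDl => //; exact: ratio_lexx.
apply: log_concaveD => //; first by apply: ratio_leX; exact: lcM.
- apply: (@ratio_le_trans _ (P m.+2 * ('X * P n)));
    rewrite ?mulf_neq0 ?polyX_eq0 ?path_poly_neq0 //.
  + exact: nneg_polyM.
  + exact: nneg_polyM.
  + by do 3!apply: nneg_polyM => //.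
  + by apply: ratio_leMl n2 => //; exact: path_poly_log_concave.
  have -> : P m.+2 * ('X * P n) = 'X * (P n * P m.+2) by ring.
  have -> : 'X * ('X * (P m * P n)) = 'X * (P n * ('X * P m)) by ring.
  by apply: ratio_leX; apply: ratio_leMl mSS2 => //; exact: path_poly_log_concave.
- apply: ratio_leX; apply: (@ratio_le_trans _ (P m.+2 * P n));
    rewrite ?mulf_neq0 ?path_poly_neq0 //.
  + exact: nneg_polyM.
  + exact: nneg_polyM.
  + exact: nneg_polyM.
  + by rewrite ![_ * P n]mulrC; apply: ratio_leMl mSS1 => //; exact: path_poly_log_concave.
  + by apply: ratio_leMl n1 => //; exact: path_poly_log_concave.
Qed.

End PathRatios.

(** * The mode of a path polynomial *)

Section PathMode.
Variable R : rcfType.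
Implicit Types (x y : R) (k n : nat).
Local Notation P := (path_poly R).

Definition rho_sqrt x : R := Num.sqrt (5 * x ^+ 2 + 4).

(** With x = n + 1, the smaller root k of (k + 1)(n - k) = (n - 2k)(n - 2k - 1), the condition for
    equal consecutive coefficients of P_n. *)
Definition rho x : R := (5 * x - 8 - rho_sqrt x) / 10.

Lemma rho_sqrt_ge0 x : 0 <= rho_sqrt x.
Proof. exact: sqrtr_ge0. Qed.

Lemma rho_sqrt_sqr x : rho_sqrt x ^+ 2 = 5 * x ^+ 2 + 4.
Proof. by rewrite sqr_sqrtr //; have := sqr_ge0 x; lra. Qed.

Lemma path_coef_ratio n k : (k <= n)%N ->
  (k.+1 * (n - k) * 'C(n - k.+1, k.+1) =
   (n - k.*2) * (n - k.*2.+1) * 'C(n - k, k))%N.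
Proof.
move=> kn; have := mul_bin_down (n - k) k; rewrite -subnS => down.
have -> : (n - k.*2 = n - k - k)%N by lia.
have -> : (n - k.*2.+1 = n - k.+1 - k)%N by lia.
rewrite mulnAC mul_bin_left -mulnA (mulnC 'C(_, _)) down.
by rewrite mulnCA mulnA.
Qed.

Lemma path_coef_lt n k : k%:R < rho n.+1%:R -> (P n)`_k < (P n)`_k.+1.
Proof.
rewrite /rho => h; rewrite !coef_path_poly ltr_nat.
have := rho_sqrt_ge0 n.+1%:R; have := rho_sqrt_sqr n.+1%:R.
move: h; set w := rho_sqrt _ => h w2 w0.
(* The hypothesis forces n >= 2k + 1; the substitution removes truncated subtraction. *)
have [N hN] : exists N, (n = k.*2.+1 + N)%N.
  exists (n - k.*2.+1)%N; rewrite subnKC // -(ltr_nat R) -addnn natrD.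
  by move: h; rewrite -[n.+1%:R]natr1; lra.
have xE : n.+1%:R = k%:R * 2 + 2 + N%:R :> R.
  by rewrite -natrM -!natrD hN; congr (_%:R); lia.
have key : (k.+1 * (n - k) < (n - k.*2) * (n - k.*2.+1))%N.
  suff : ((k + 1) * (k + 1 + N) < (N + 1) * N)%N by rewrite hN; nia.
  rewrite -(ltr_nat R) !natrM !natrD.
  have {}h : w < 2 + 5 * N%:R by move: h; rewrite xE; lra.
  have : w ^+ 2 < (2 + 5 * N%:R) ^+ 2 by rewrite ltrXn2r // (le_trans w0 (ltW h)).
  by rewrite w2 xE; lra.
have kn : (k <= n - k)%N by lia.
rewrite -(ltn_pmul2l (_ : 0 < k.+1 * (n - k))%N); last by rewrite muln_gt0; lia.
by rewrite path_coef_ratio ?ltn_pmul2r ?bin_gt0 //; lia.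
Qed.

Lemma path_coef_ge n k : rho n.+1%:R <= k%:R -> (P n)`_k.+1 <= (P n)`_k.
Proof.
rewrite /rho => h; rewrite !coef_path_poly ler_nat.
(* Here the coefficient of degree k + 1 vanishes; this also covers every k beyond the larger root of
   the quadratic. *)
case: (leqP n k.*2.+1) => kn; first by rewrite bin_small //; lia.
have := rho_sqrt_sqr n.+1%:R; move: h; set w := rho_sqrt _ => h w2.
have [N hN] : exists N, (n = k.*2.+2 + N)%N.
  by exists (n - k.*2.+2)%N; rewrite subnKC.
have xE : n.+1%:R = k%:R * 2 + 3 + N%:R :> R.
  by rewrite -natrM -!natrD hN; congr (_%:R); lia.
have key : ((n - k.*2) * (n - k.*2.+1) <= k.+1 * (n - k))%N.
  suff : ((N + 2) * (N + 1) <= (k + 1) * (k + 2 + N))%N by rewrite hN; nia.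
  rewrite -(ler_nat R) !natrM !natrD.
  have {}h : 7 + 5 * N%:R <= w by move: h; rewrite xE; lra.
  have N0 : 0 <= 7 + 5 * N%:R :> R by have := ler0n R N; lra.
  have : (7 + 5 * N%:R) ^+ 2 <= w ^+ 2 by rewrite lerXn2r // nnegrE // (le_trans N0 h).
  by rewrite w2 xE; lra.
rewrite -(leq_pmul2l (_ : 0 < k.+1 * (n - k))%N); last by rewrite muln_gt0; lia.
by rewrite path_coef_ratio ?leq_mul2r ?key ?orbT //; lia.
Qed.

End PathMode.

(** * Vertex deletion for independence polynomials *)

Section IndepPolyRec.
Variables (R : realType) (T : finType) (e : rel T).
Hypothesis e_sym : symmetric e.
Implicit Types (S A : {set T}) (v : T).

(** The independence polynomial of the subgraph induced on [S], kept inside [T] so that deletions do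
    not change the vertex type. *)
Definition indep_poly_in S : {poly R} :=
  \sum_(A : {set T} | (A \subset S) && independent e A) 'X^#|A|.

Lemma indep_poly_inT : indep_poly_in [set: T] = indep_poly e R.
Proof.
apply/polyP => k; rewrite coef_poly coef_sum.
under eq_bigl do rewrite subsetT /=.
rewrite ltnS; transitivity ((nb_indep e k)%:R : R); last first.
  case: leqP => // kT; apply/eqP; rewrite pnatr_eq0 cards_eq0 -subset0.
  apply/subsetP => A; rewrite inE => /andP[_ /eqP Ak].
  by move: kT; rewrite -Ak ltnNge max_card.
rewrite /nb_indep -sum1dep_card natr_sum [RHS]big_mkcondr.
by apply: eq_bigr => A _; rewrite coefXn eq_sym; case: eqP.
Qed.

Lemma indep_poly_in0 : indep_poly_in set0 = 1.
Proof.
rewrite /indep_poly_in (big_pred1 set0) ?cards0 // => A.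
rewrite subset0 andb_idr // => /eqP->.
by apply/forall_inP => x; rewrite inE.
Qed.

Lemma independentU1 v A : v \notin A ->
  independent e (v |: A) = independent e A && [forall u in A, ~~ e v u].
Proof.
move=> vA; apply/idP/andP => [/forall_inP h|[/forall_inP h /forall_inP hv]].
  split; last first.
    apply/forall_inP => u uA; have /forall_inP := h v (setU11 _ _).
    move=> /(_ u); rewrite inE uA orbT => /(_ isT) /implyP; apply.
    by apply: contraNneq vA => ->.
  apply/forall_inP => x xA; apply/forall_inP => y yA.
  have /forall_inP := h x (setU1r _ xA).
  by apply; exact: setU1r.
apply/forall_inP => x /setU1P[->|xA]; apply/forall_inP => y /setU1P[->|yA].
- by rewrite eqxx.
- by rewrite hv ?implybT.
- by rewrite e_sym hv ?implybT.
- by have /forall_inP := h x xA; apply.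
Qed.

(** Independent sets are split by membership of [v]; those containing [v] correspond to independent
    sets in [S2] by removing [v]. *)
Lemma indep_poly_in_rec v S S1 S2 : v \in S ->
  S1 = S :\ v -> S2 = [set u in S1 | ~~ e v u] ->
  indep_poly_in S = indep_poly_in S1 + 'X * indep_poly_in S2.
Proof.
move=> vS -> ->; rewrite /indep_poly_in (bigID (fun A => v \in A)) /= addrC.
congr (_ + _).
  by apply: eq_bigl => A; rewrite subsetD1 andbAC.
rewrite (reindex_onto (fun A => v |: A) (fun A => A :\ v)) /=; last first.
  by move=> A /andP[_ vA]; rewrite setD1K.
rewrite mulr_sumr; apply: eq_big => [A|A].
  have [vA|vA] := boolP (v \in A).
    rewrite (_ : ((v |: A) :\ v == A) = false) ?andbF; last first.
      by apply/negbTE; apply: contraTneq vA => <-; rewrite !inE eqxx.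
    apply/esym/negbTE; apply: contraL vA => /andP[/subsetP AS _].
    by apply/negP => /AS; rewrite !inE eqxx.
  rewrite setU11 andbT setU1K // eqxx andbT subUset sub1set vS independentU1 //=.
  rewrite andbA [in RHS](_ : (A \subset _) = (A \subset S) && [forall u in A, ~~ e v u]).
    by rewrite andbAC.
  apply/subsetP/andP => [AS|[/subsetP AS /forall_inP Av] u uA].
    split; first by apply/subsetP => u /AS; rewrite !inE => /andP[/andP[]].
    by apply/forall_inP => u /AS; rewrite !inE => /andP[].
  by rewrite !inE AS // Av // !andbT; apply: contraNneq vA => <-.
move=> /andP[/andP[_ _] /eqP vA]; rewrite -exprS cardsU1; congr ('X^_).
by rewrite -vA !inE eqxx.
Qed.

End IndepPolyRec.

(** * The independence polynomial of the tadpole *)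

Section TadpolePolynomial.
Variables (R : realType) (m n : nat).
Implicit Types (a b c l : nat).
Local Notation P := (path_poly R).
Local Notation I := (indep_poly_in R (@tadpole m n)).

(** The shape of every vertex set left by the successive deletions: an interval of the cycle and a
    final stretch of the tail. *)
Definition tadpole_segment a b c : {set ('I_m + 'I_n)%type} :=
  [set u : ('I_m + 'I_n)%type |
    match u with inl i => (a <= i < b)%N | inr j => (c <= j)%N end].

Lemma indep_poly_path_segment a l : (l <= n)%N ->
  I (tadpole_segment a a (n - l)) = P l.+1.
Proof.
elim/ltn_ind: l => -[|[|l]] IH ln.
- rewrite (_ : tadpole_segment _ _ _ = set0) ?indep_poly_in0 //.
  by apply/setP => -[i|j]; rewrite !inE /=; [|have := ltn_ord j]; lia.
- have j0 : (n - 1 < n)%N by lia.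
  rewrite (indep_poly_in_rec R (@tadpole_sym m n) (v := inr (Ordinal j0))
    (S1 := set0) (S2 := set0)) ?indep_poly_in0 //.
  + by rewrite inE /=.
  + apply/setP => -[i|j]; rewrite !inE /=; first lia.
    by rewrite (inj_eq inr_inj) -val_eqE /=; have := ltn_ord j; lia.
  + by apply/setP => -[i|j]; rewrite !inE.
have j0 : (n - l.+2 < n)%N by lia.
rewrite (indep_poly_in_rec R (@tadpole_sym m n) (v := inr (Ordinal j0))
    (S1 := tadpole_segment a a (n - l.+1)) (S2 := tadpole_segment a a (n - l))).
- by rewrite !IH //; lia.
- by rewrite inE /=.
- apply/setP => -[i|j]; rewrite !inE /=; first lia.
  by rewrite (inj_eq inr_inj) -val_eqE /=; lia.
- apply/setP => -[i|j]; rewrite !inE /tadpole /=; first lia.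
  lia.
Qed.

(** The bound a + l < m keeps x_m out, so the interval is a path with no edge to the tail. *)
Lemma indep_poly_segment a l c : (a + l < m)%N -> (c <= n)%N ->
  I (tadpole_segment a (a + l) c) = P l.+1 * P (n - c).+1.
Proof.
move=> + cn; elim/ltn_ind: l => -[|[|l]] IH lm.
- by rewrite addn0 mul1r -(indep_poly_path_segment a (leq_subr c n)) subKn.
- have i0 : (a < m)%N by lia.
  rewrite (indep_poly_in_rec R (@tadpole_sym m n) (v := inl (Ordinal i0))
    (S1 := tadpole_segment a a c) (S2 := tadpole_segment a a c)).
  + rewrite -{1 2}(subKn cn) !indep_poly_path_segment ?leq_subr //.
    by rewrite /=; ring.
  + by rewrite inE /=; lia.
  + apply/setP => -[i|j]; rewrite !inE /= //.
    by rewrite (inj_eq inl_inj) -val_eqE /=; lia.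
  + by apply/setP => -[i|j]; rewrite !inE /tadpole /=; lia.
have i0 : (a + l.+1 < m)%N by lia.
rewrite (indep_poly_in_rec R (@tadpole_sym m n) (v := inl (Ordinal i0))
    (S1 := tadpole_segment a (a + l.+1) c) (S2 := tadpole_segment a (a + l) c)).
- by rewrite !IH ?path_polySS; [ring | lia..].
- by rewrite inE /=; lia.
- apply/setP => -[i|j]; rewrite !inE /= //.
  by rewrite (inj_eq inl_inj) -val_eqE /=; lia.
- by apply/setP => -[i|j]; rewrite !inE /tadpole /=; lia.
Qed.

Lemma indep_poly_tadpole : (3 <= m)%N -> (1 <= n)%N ->
  indep_poly (@tadpole m n) R = P m * P n.+1 + 'X * (P (m - 2) * P n).
Proof.
move=> m3 n1; rewrite -indep_poly_inT.
have i0 : (m - 1 < m)%N by lia.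
(* The deleted vertex is x_m, with neighbours x_1, x_(m-1) and y_1; the second segment is x_2, ...,
   x_(m-2) with the tail from y_2. *)
rewrite (indep_poly_in_rec R (@tadpole_sym m n) (v := inl (Ordinal i0))
    (S1 := tadpole_segment 0 (0 + (m - 1)) 0)
    (S2 := tadpole_segment 1 (1 + (m - 3)) 1)).
- rewrite !indep_poly_segment; [|lia..].
  by rewrite subn0; congr (P _ * _ + 'X * (P _ * P _)); lia.
- by rewrite inE.
- apply/setP => -[i|j]; rewrite !inE /= //.
  by rewrite (inj_eq inl_inj) -val_eqE /=; have := ltn_ord i; lia.
- apply/setP => -[i|j]; rewrite !inE /tadpole /=; [have := ltn_ord i|]; lia.
Qed.

End TadpolePolynomial.

(** * Estimates for [rho] *)

Section RhoBounds.
Variable R : rcfType.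
Implicit Types x y : R.
Local Notation w := (@rho_sqrt R).

Lemma rho_sqrt_le x y : 0 <= y -> 5 * x ^+ 2 + 4 <= y ^+ 2 -> w x <= y.
Proof.
by move=> y0; rewrite -rho_sqrt_sqr ler_pXn2r ?nnegrE ?rho_sqrt_ge0.
Qed.

Lemma rho_sqrt_ge x y : 0 <= y -> y ^+ 2 <= 5 * x ^+ 2 + 4 -> y <= w x.
Proof.
by move=> y0; rewrite -rho_sqrt_sqr ler_pXn2r ?nnegrE ?rho_sqrt_ge0.
Qed.

(** This puts [rho] within 1/5 of a linear function, which reduces the near-additivity bounds below
    to linear arithmetic. *)
Lemma rho_sqrt_linear x : 0 <= x ->
  Num.sqrt 5 * x <= w x <= Num.sqrt 5 * x + 2.
Proof.
move=> x0; have c0 := @sqrtr_ge0 R 5.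
have c2 : Num.sqrt 5 ^+ 2 = 5 :> R by rewrite sqr_sqrtr.
have cx0 := mulr_ge0 c0 x0.
apply/andP; split; first by apply: rho_sqrt_ge; rewrite ?exprMn ?c2 //; lra.
by apply: rho_sqrt_le; [lra | rewrite sqrrD exprMn c2; lra].
Qed.

Lemma rho_mono x y : 0 <= x -> x <= y -> rho x <= rho y.
Proof.
move=> x0 xy; rewrite /rho.
suff : w y <= w x + 5 * (y - x) by lra.
have wx0 := rho_sqrt_ge0 x; have wx2 := rho_sqrt_sqr x.
have wx : 2 * x <= w x by apply: rho_sqrt_ge; nra.
by apply: rho_sqrt_le; [lra | rewrite sqrrD wx2; nra].
Qed.

Lemma rho_add4 x : 0 <= x -> rho (x + 4) <= rho x + 2.
Proof.
move=> x0; rewrite /rho.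
suff : w x <= w (x + 4) by lra.
by apply: rho_sqrt_le; [exact: rho_sqrt_ge0 | rewrite rho_sqrt_sqr; nra].
Qed.

(** The asymptotic slope of [rho] is (5 - sqrt 5) / 10, and 7 times it is just below 2. *)
Lemma rho_add7 x : 1 <= x -> rho (x + 7) <= rho x + 2.
Proof.
move=> x1; rewrite /rho.
suff : w x + 15 <= w (x + 7) by lra.
have wx0 := rho_sqrt_ge0 x; have wx2 := rho_sqrt_sqr x.
(* The bound to which the squared goal reduces, with equality at x = 1. *)
have wx : w x <= (7 * x + 2) / 3 by apply: rho_sqrt_le; nra.
by apply: rho_sqrt_ge; [lra | rewrite sqrrD wx2; nra].
Qed.

Lemma rho_gt0 x : 3 < x -> 0 < rho x.
Proof.
move=> x3; rewrite /rho.
have wx0 := rho_sqrt_ge0 x; have wx2 := rho_sqrt_sqr x.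
suff : w x < 5 * x - 8 by lra.
by rewrite -(@ltr_pXn2r _ 2) ?nnegrE ?wx2 //; nra.
Qed.

Lemma rho7_le2 : rho 7 <= 2 :> R.
Proof.
rewrite /rho; suff : 7 <= w 7 by lra.
by apply: rho_sqrt_ge; lra.
Qed.

Lemma rho_subadd x y : 1 <= x -> 1 <= y -> rho (x + y - 1) <= rho x + rho y + 1.
Proof.
move=> x1 y1; rewrite /rho.
have c0 := @sqrtr_ge0 R 5.
have c2 : Num.sqrt 5 ^+ 2 = 5 :> R by rewrite sqr_sqrtr.
have /andP[_ hx] : _ := @rho_sqrt_linear x ltac:(lra).
have /andP[_ hy] : _ := @rho_sqrt_linear y ltac:(lra).
have /andP[hz _] : _ := @rho_sqrt_linear (x + y - 1) ltac:(lra).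
have : Num.sqrt 5 <= 3 :> R by nra.
by lra.
Qed.

Lemma rho_superadd x y : 3 <= x -> 0 <= y ->
  rho x + rho y - 1 <= rho (x + y - 3).
Proof.
move=> x3 y0; rewrite /rho.
have c0 := @sqrtr_ge0 R 5.
have c2 : Num.sqrt 5 ^+ 2 = 5 :> R by rewrite sqr_sqrtr.
have /andP[hx _] : _ := @rho_sqrt_linear x ltac:(lra).
have /andP[hy _] : _ := @rho_sqrt_linear y ltac:(lra).
have /andP[_ hz] : _ := @rho_sqrt_linear (x + y - 3) ltac:(lra).
have : 2 <= Num.sqrt 5 :> R by nra.
by lra.
Qed.

Lemma rho_superadd0 x y : 0 <= x -> 0 <= y -> rho x + rho y <= rho (x + y).
Proof.
move=> x0 y0; rewrite /rho.
have /andP[hx _] : _ := @rho_sqrt_linear x ltac:(lra).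
have /andP[hy _] : _ := @rho_sqrt_linear y ltac:(lra).
have /andP[_ hz] : _ := @rho_sqrt_linear (x + y) ltac:(lra).
by lra.
Qed.

End RhoBounds.

(** * Ascents and descents of the tadpole coefficients *)

Section TadpoleMode.
Variable R : rcfType.
Implicit Types (k m n a b : nat).
Local Notation P := (path_poly R).

(** By [path_polyM], the path summand rises strictly at k; the other is shifted by 2 while its index
    sum drops by 4, which [rho_add4] absorbs. *)
Lemma path_polyM_lt a b k : k%:R < rho (a + b)%:R :> R ->
  (P a * P b)`_k < (P a * P b)`_k.+1.
Proof.
elim/ltn_ind: a b k => -[|[|a]] IH b k kab.
- rewrite mul1r; apply/path_coef_lt/(lt_le_trans kab)/rho_mono.
    exact: ler0n.
  by rewrite ler_nat; lia.
- by rewrite mul1r; apply: path_coef_lt.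
case: b kab => [|[|b]] kab.
- rewrite mulr1; apply/path_coef_lt/(lt_le_trans kab)/rho_mono.
    exact: ler0n.
  by rewrite ler_nat; lia.
- by rewrite mulr1; apply: path_coef_lt; rewrite -addn1.
have pk : (P (a + b).+3)`_k < (P (a + b).+3)`_k.+1.
  by apply: path_coef_lt; move: kab; rewrite !addnS !addSn.
rewrite path_polyM; move: (P _.+3) pk => p pk.
rewrite !coefD; apply: ltr_leD => //.
rewrite !coefXnM; case: k kab {pk} => [|[|k]] kab //=.
  by apply: nneg_polyM; exact: path_poly_nneg.
rewrite !subSS !subn0; apply/ltW/IH => //.
have := @rho_add4 R (a + b)%:R (ler0n _ _).
rewrite -natrD (_ : a + b + 4 = a.+2 + b.+2)%N; last lia.
by move: kab; rewrite -addn2 natrD; lra.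
Qed.

Lemma path_poly_split r :
  P r.+4.+2 - 'X^2 * P r.+1 = P r.+4 + 'X * P r.+2 + 'X * P r.+4.
Proof. by rewrite !path_polySS; ring. Qed.

Lemma tadpole_coef_ge a n j : (1 <= n)%N ->
  let T := P a.+4 * P n.+1 + 'X * (P a.+2 * P n) in
  rho (a + n + 4)%:R <= j%:R :> R -> j%:R - 1 < rho (a + n + 4)%:R :> R ->
  T`_j.+2 <= T`_j.+1.
Proof.
move=> n1 /= le_j j_lt; rewrite tadpole_polyE.
have [r rE] : exists r, (a + n = r.+1)%N by exists (a + n).-1; lia.
(* If a = 0 or n = 1 the product is already a path polynomial and Q = 0; otherwise [path_polyM]
   gives Q. *)
have [Q QE Q_le] : exists2 Q : {poly R}, P a.+1 * P n = P (a + n) + 'X^2 * Q &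
    ('X^4 * Q)`_j.+1 <= ('X^4 * Q)`_j.+2.
  case: a n n1 rE le_j j_lt => [|a] [|[|n]] // _ rE le_j j_lt.
  - by exists 0; rewrite mulr0 ?coef0 // addr0 mul1r.
  - by exists 0; rewrite mulr0 ?coef0 // addr0 mul1r.
  - by exists 0; rewrite mulr0 ?coef0 // addr0 mulr1 addn1.
  exists (P a * P n).
    by rewrite path_polyM addSn !addnS.
  have PP0 : nneg_poly (P a * P n) by apply: nneg_polyM; exact: path_poly_nneg.
  rewrite !coefXnM; case: j le_j j_lt => [|[|[|j]]] le_j j_lt //=.
  rewrite !subSS !subn0; apply/ltW/path_polyM_lt.
  move: j_lt le_j; have -> : (a.+1 + n.+2 + 4 = a + n + 7)%N by lia.
  (* [rho_add7] needs a + n >= 1; at 0, the bound rho 7 <= 2 excludes the remaining degrees. *)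
  have [->|an] := posnP (a + n).
    by have := rho7_le2 R; rewrite add0n -addn3 natrD; have := ler0n R j; lra.
  rewrite natrD; have := @rho_add7 R (a + n)%:R; rewrite ler1n => /(_ an).
  by rewrite -addn3 natrD; lra.
rewrite QE mulrDr mulrA -exprD rE opprD addrA path_poly_split.
have sE : (a + n + 4 = r.+4.+1)%N by lia.
rewrite sE in le_j.
have h1 : (P r.+4)`_j.+2 <= (P r.+4)`_j.+1.
  by apply/path_coef_ge/(le_trans le_j); rewrite ler_nat.
have h2 : (P r.+2)`_j.+1 <= (P r.+2)`_j.
  by apply/path_coef_ge/le_trans/le_j/rho_mono; rewrite ?ler0n // ler_nat; lia.
have h3 : (P r.+4)`_j.+1 <= (P r.+4)`_j by exact: path_coef_ge.
move: (P r.+4) (P r.+2) h1 h2 h3 => p q h1 h2 h3.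
by rewrite !(coefB, coefD) lerB // !coefXM /= !lerD.
Qed.

Lemma tadpole_coef_lt m n k :
  k%:R < rho (m.+2 + n.+1)%:R :> R -> k%:R - 1 < rho (m + n)%:R :> R ->
  let T := P m.+2 * P n.+1 + 'X * (P m * P n) in T`_k < T`_k.+1.
Proof.
move=> k1 k2 /=; have := path_polyM_lt k1.
move: (P m.+2 * P n.+1) => p p_lt; rewrite !coefD; apply: ltr_leD => //.
rewrite !coefXM /=; case: k k1 k2 p_lt => [|k] _ k2 _ /=.
  by apply: nneg_polyM; exact: path_poly_nneg.
by apply/ltW/path_polyM_lt; move: k2; rewrite -natr1 addrK.
Qed.

End TadpoleMode.

(** * Unimodality and the bounds on the mode *)

Lemma lambdaE (R : realType) n : lambda R n = Num.ceil (rho n.+2%:R : R).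
Proof.
rewrite /lambda /rho /rho_sqrt -addn2 natrD.
congr (Num.ceil ((_ - Num.sqrt _) / _)).
  by ring.
by ring.
Qed.

Lemma tadpole_nneg_poly (R : realType) m n :
  nneg_poly (indep_poly (@tadpole m n) R).
Proof. by move=> k; rewrite coef_poly; case: ifP => // _; rewrite ler0n. Qed.

Lemma tadpole_indep_mode (R : realType) m n : (3 <= m)%N -> (1 <= n)%N ->
  let T := indep_poly (@tadpole m n) R in
  exists i, [/\ (i < size T)%N, 0 < T`_i,
    forall k, (k < i)%N -> T`_k < T`_k.+1 &
    forall k, (i <= k)%N -> T`_k.+1 <= T`_k].
Proof.
move=> m3 n1 /=; apply: log_concave_mode; first exact: tadpole_nneg_poly.
  rewrite indep_poly_tadpole // coefD coefXM addr0 coef0M !coef_path_poly !bin0.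
  by rewrite mulr1 ltr01.
rewrite indep_poly_tadpole // (_ : m = (m - 2).+2); last lia.
by rewrite subSS subn1; apply: tadpole_poly_log_concave.
Qed.

Theorem theorem1p3 (R : realType) :
  (forall m n : nat, (3 <= m)%N -> (1 <= n)%N ->
     unimodal (indep_poly (@tadpole m n) R)) /\
  (forall m n : nat, (4 <= m)%N -> (1 <= n)%N ->
     exists mu : nat,
       is_mode (indep_poly (@tadpole m n) R) mu /\
       lambda R (m - 3) + lambda R n - 1 <= mu%:Z
         <= lambda R (m - 3) + lambda R n + 2).
Proof.
split=> m n m3 n1.
  have [i [isz _ up down]] := tadpole_indep_mode R m3 n1.
  split; [by rewrite -size_poly_gt0 (leq_ltn_trans _ isz) | exact: tadpole_nneg_poly |].
  by exists i => //; split=> [k /up/ltW|k /down].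
have [i [isz i_gt0 up down]] := tadpole_indep_mode R (ltnW m3) n1.
exists i; split.
  split=> // [|k /down //].
  by case: i i_gt0 {isz down} up => [|i] _ up //; exact: up.
rewrite !lambdaE.
have [a mE] : exists a, (m = a.+4)%N by exists (m - 4)%N; lia.
have T_E := indep_poly_tadpole R (ltnW m3) n1.
have -> : (m - 3).+2 = a.+3 by lia.
have : (Num.ceil (rho a.+3%:R : R) - 1)%:~R < rho a.+3%:R :> R := ceilB1_lt _.
have : rho a.+3%:R <= (Num.ceil (rho a.+3%:R : R))%:~R :> R := ceil_ge _.
have : (Num.ceil (rho n.+2%:R : R) - 1)%:~R < rho n.+2%:R :> R := ceilB1_lt _.
have : rho n.+2%:R <= (Num.ceil (rho n.+2%:R : R))%:~R :> R := ceil_ge _.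
set u := Num.ceil (rho a.+3%:R); set v := Num.ceil (rho n.+2%:R).
rewrite !intrB => vge vlt uge ult.
rewrite {m3}mE !subSS subn0 in up down T_E *.
apply/andP; split; rewrite leNgt; apply/negP => i_lt.
  (* The largest value of a mode violating the lower bound; a strict ascent at [k] contradicts the
     descent after the mode. *)
  pose k := absz (u + v - 2)%R.
  have kE : k%:Z = u + v - 2 by lia.
  have ik : (i <= k)%N by lia.
  have := down _ ik; rewrite T_E leNgt => /negP; apply.
  have kR : k%:R = u%:~R + v%:~R - 2 :> R by rewrite pmulrn kE intrB intrD.
  apply: tadpole_coef_lt.
    have := @rho_superadd0 R a.+3%:R n.+2%:R (ler0n _ _) (ler0n _ _).
    by rewrite -natrD (_ : a.+3 + n.+2 = a.+4 + n.+1)%N; [lra | lia].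
  have := @rho_superadd R a.+3%:R n.+2%:R; rewrite ler_nat ler0n => /(_ isT isT).
  have -> : a.+3%:R + n.+2%:R - 3 = (a.+2 + n)%:R :> R.
    by rewrite -natrD (_ : a.+3 + n.+2 = a.+2 + n + 3)%N ?natrD ?addrK //; lia.
  by lra.
(* Since a + n + 4 = m + n, the ceiling j of [s] is the mode of P_(m+n-1). Near-additivity gives j +
   1 <= u + v + 2, and there is no ascent at j + 1. *)
pose s : R := rho (a + n + 4)%:R.
have s_gt0 : 0 < s by apply: rho_gt0; rewrite ltr_nat; lia.
have s_le := ceil_ge s; have s_lt := ceilB1_lt s; rewrite intrB in s_lt.
have s_ceil : 0 < Num.ceil s by rewrite ceil_gt0.
pose j := absz (Num.ceil s); have jE : j%:Z = Num.ceil s by lia.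
have jR : j%:R = (Num.ceil s)%:~R :> R by rewrite -jE.
have : (j%:Z < u + v + 2)%R.
  rewrite -(ltr_int R) jE !intrD.
  have := @rho_subadd R a.+3%:R n.+2%:R; rewrite !ler1n => /(_ isT isT).
  have -> : a.+3%:R + n.+2%:R - 1 = (a + n + 4)%:R :> R.
    by rewrite -natrD (_ : a.+3 + n.+2 = a + n + 4 + 1)%N ?natrD ?addrK //; lia.
  by rewrite -/s; lra.
move=> j_lt; have ji : (j.+1 < i)%N by lia.
have := up _ ji; rewrite T_E ltNge => /negP; apply.
by apply: tadpole_coef_ge; rewrite // jR.
Qed.
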